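(* Let $(A,\leq,0,1)$ be a finite bounded poset, $(T,R)$ a time frame with reflexive $R$ and $X\in\{P,F,H,G\}$. Then $H*X\leq X$, $G*X\leq X$, $X\leq P*X$ and $X\leq F*X$; in particular $P\leq P*P$, $F\leq F*F$, $H*H\leq H$ and $G*G\leq G$.
   Context: For $D\subseteq A$: $L(D)$, $U(D)$ are the sets of lower and upper bounds; $\operatorname{Max}D$, $\operatorname{Min}D$ the sets of maximal and minimal elements. A time frame is $(T,R)$ with $T\neq\emptyset$, $R\subseteq T^2$. Tense operators on nonempty $B\subseteq A^T$ (with $q\in A^T$ identified with $\{q\}$) and $s\in T$: $P(B)(s)=\operatorname{Min}U(\{q(t)\mid q\in B,t\mathrel Rs\})$, $F(B)(s)=\operatorname{Min}U(\{q(t)\mid q\in B,s\mathrel Rt\})$, $H(B)(s)=\operatorname{Max}L(\{q(t)\mid q\in B,t\mathrel Rs\})$, $G(B)(s)=\operatorname{Max}L(\{q(t)\mid q\in B,s\mathrel Rt\})$, with values in $(2^A\setminus\{\emptyset\})^T$. The transformation function is $\varphi(x)=\{q\in A^T\mid q(t)\in x(t)\ \forall t\in T\}$, and $Y*X:=Y\circ\varphi\circ X$. For nonempty $D,E\subseteq A$, $D\leq E$ iff $d\leq e$ for all $d\in D,e\in E$; for maps $X,Y\colon A^T\to(2^A\setminus\{\emptyset\})^T$, $X\leq Y$ means $X(q)(s)\leq Y(q)(s)$ for all $q\in A^T$, $s\in T$. *)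

(* Defs.v *)
From HB Require Import structures.
From mathcomp Require Import all_boot all_order.
From mathcomp Require Import boolp classical_sets.
Set Implicit Arguments.
Unset Strict Implicit.
Unset Printing Implicit Defensive.
Import Order.TTheory.
Local Open Scope classical_set_scope.
Local Open Scope order_scope.

Record nset (E : Type) := NSet {
  nset_val :> set E;
  nset_neq0 : nset_val !=set0 }.

Definition nset1 (E : Type) (q : E) : nset E :=
  NSet (ex_intro [set q] q erefl).

Section Extrema.
Context {d : Order.disp_t}.

Definition Maxs {A : porderType d} (D : set A) : set A :=
  [set m | D m /\ forall x, D x -> m <= x -> x = m].

Definition Mins {A : porderType d} (D : set A) : set A :=
  [set m | D m /\ forall x, D x -> x <= m -> x = m].

Lemma Maxs_neq0 (A : finPOrderType d) (D : set A) : D !=set0 -> Maxs D !=set0.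
Proof.
move=> [x0 /asboolP Dx0].
case: (@arg_minnP _ x0 (fun x => `[< D x >])
  (fun x => #|[pred y | x < y]|) Dx0) => m /asboolP Dm mmin.
exists m; split=> // x Dx mx; apply/eqP/negPn/negP => xm.
have ltmx : m < x by rewrite lt_neqAle eq_sym xm.
have /mmin := asboolT Dx; rewrite leqNgt => /negP; apply.
apply/proper_card/properP; split.
  by apply/fintype.subsetP => y; rewrite !inE; apply: lt_trans.
by exists x; rewrite !inE ?ltxx.
Qed.

Lemma Mins_neq0 (A : finPOrderType d) (D : set A) : D !=set0 -> Mins D !=set0.
Proof.
move=> [x0 /asboolP Dx0].
case: (@arg_minnP _ x0 (fun x => `[< D x >])
  (fun x => #|[pred y | y < x]|) Dx0) => m /asboolP Dm mmin.
exists m; split=> // x Dx xm; apply/eqP/negPn/negP => nxm.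
have ltxm : x < m by rewrite lt_neqAle nxm.
have /mmin := asboolT Dx; rewrite leqNgt => /negP; apply.
apply/proper_card/properP; split.
  by apply/fintype.subsetP => y; rewrite !inE => /lt_trans; apply.
by exists x; rewrite !inE ?ltxx.
Qed.

Context {A : finTBPOrderType d}.

Lemma MinU_neq0 (D : set A) : Mins (ubound D) !=set0.
Proof. by apply: Mins_neq0; exists \top => x _; exact: lex1. Qed.

Lemma MaxL_neq0 (D : set A) : Maxs (lbound D) !=set0.
Proof. by apply: Maxs_neq0; exists \bot => x _; exact: le0x. Qed.

Definition MinU (D : set A) : nset A := NSet (MinU_neq0 D).
Definition MaxL (D : set A) : nset A := NSet (MaxL_neq0 D).

End Extrema.

Section Tense.
Context {d : Order.disp_t} (A : finTBPOrderType d) {T : Type}.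

Definition tense_op := nset (T -> A) -> T -> nset A.

Section Operators.
Variable R : T -> T -> Prop.

Definition past_values (B : set (T -> A)) (s : T) : set A :=
  [set a | exists q t, [/\ B q, R t s & a = q t]].

Definition future_values (B : set (T -> A)) (s : T) : set A :=
  [set a | exists q t, [/\ B q, R s t & a = q t]].

Definition opP : tense_op := fun B s => MinU (past_values B s).
Definition opF : tense_op := fun B s => MinU (future_values B s).
Definition opH : tense_op := fun B s => MaxL (past_values B s).
Definition opG : tense_op := fun B s => MaxL (future_values B s).

End Operators.

Lemma phi_neq0 (x : T -> nset A) :
  [set q : T -> A | forall t, nset_val (x t) (q t)] !=set0.
Proof.
have [q qx] := choice (fun t => nset_neq0 (x t)).
by exists q.
Qed.

Definition phi (x : T -> nset A) : nset (T -> A) := NSet (phi_neq0 x).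

Definition star (Y X : tense_op) : tense_op := fun B => Y (phi (X B)).

Definition le_nset (D E : nset A) : Prop :=
  forall a b, nset_val D a -> nset_val E b -> a <= b.

(* Operators are compared as maps on [T -> A] only, an element [q] being
   identified with the singleton [nset1 q]. *)
Definition le_op (X Y : tense_op) : Prop :=
  forall (q : T -> A) (s : T), le_nset (X (nset1 q) s) (Y (nset1 q) s).

End Tense.

Arguments tense_op {d} A T.
Arguments opP {d} A {T} R B s.
Arguments opF {d} A {T} R B s.
Arguments opH {d} A {T} R B s.
Arguments opG {d} A {T} R B s.
Arguments phi {d A T} x.
Arguments star {d A T} Y X B.
Arguments le_nset {d A} D E.
Arguments le_op {d A T} X Y.

(* Main.v *)
Require Import Defs.
From mathcomp Require Import all_boot all_order.
From mathcomp Require boolp.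

(* Every element of [x s] is the value at [s] of some selection in [phi x].
   Since [R s s], all of [X(q)(s)] is therefore among the values of which
   [Y * X] takes lower (for [H], [G]) or upper (for [P], [F]) bounds at [s]. *)

Lemma phi_surj (d : Order.disp_t) (A : finTBPOrderType d) (T : Type)
    (x : T -> nset A) (s : T) (b : A) :
  nset_val (x s) b -> exists2 q, nset_val (phi x) q & q s = b.
Proof.
move=> xb; have [q0 q0x] := nset_neq0 (phi x).
(* An arbitrary selection [q0] is changed at the single time [s], where it takes the value [b];
   equality on [T] is decided classically. *)
exists (fun t => if boolp.pselect (t = s) then b else q0 t).
  by move=> t /=; case: boolp.pselect => [ts|_] /=; [rewrite ts | exact: q0x].
by case: boolp.pselect.
Qed.

Section ReflexiveFrame.
Context (d : Order.disp_t) (A : finTBPOrderType d) (T : Type).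
Variables (R : T -> T -> Prop) (R_refl : forall t, R t t).

Lemma past_values_phi (x : T -> nset A) (s : T) (b : A) :
  nset_val (x s) b -> past_values R (phi x) s b.
(* By reflexivity, [s] itself serves as the past time. *)
Proof. by move=> /(@phi_surj _ _ _ x s b)[q qx <-]; exists q, s. Qed.

Lemma future_values_phi (x : T -> nset A) (s : T) (b : A) :
  nset_val (x s) b -> future_values R (phi x) s b.
Proof. by move=> /(@phi_surj _ _ _ x s b)[q qx <-]; exists q, s. Qed.

(** A maximal lower bound is in particular a lower bound, and [b] is one of the bounded values. *)
Lemma star_opH_le (X : tense_op A T) : le_op (star (opH A R) X) X.
Proof. by move=> q s a b [aL _] /(past_values_phi (X (nset1 q))); exact: aL. Qed.

Lemma star_opG_le (X : tense_op A T) : le_op (star (opG A R) X) X.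
Proof. by move=> q s a b [aL _] /(future_values_phi (X (nset1 q))); exact: aL. Qed.

(** Dually, [b] is an upper bound of a set that contains [a]. *)
Lemma le_star_opP (X : tense_op A T) : le_op X (star (opP A R) X).
Proof. by move=> q s a b /(past_values_phi (X (nset1 q))) Xa [bU _]; exact: bU. Qed.

Lemma le_star_opF (X : tense_op A T) : le_op X (star (opF A R) X).
Proof. by move=> q s a b /(future_values_phi (X (nset1 q))) Xa [bU _]; exact: bU. Qed.

End ReflexiveFrame.

Theorem theorem12 (d : Order.disp_t) (A : finTBPOrderType d)
    (T : Type) (T_neq0 : inhabited T)
    (R : T -> T -> Prop) (R_refl : forall t : T, R t t) :
  (forall X : tense_op A T,
     [\/ X = opP A R, X = opF A R, X = opH A R | X = opG A R] ->
     [/\ le_op (star (opH A R) X) X,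
         le_op (star (opG A R) X) X,
         le_op X (star (opP A R) X) &
         le_op X (star (opF A R) X)]) /\
  [/\ le_op (opP A R) (star (opP A R) (opP A R)),
      le_op (opF A R) (star (opF A R) (opF A R)),
      le_op (star (opH A R) (opH A R)) (opH A R) &
      le_op (star (opG A R) (opG A R)) (opG A R)].
Proof.
(* The four self-compositions are instances in which [X] is the outer operator itself. *)
by split=> [X _|]; split; by
  [exact: star_opH_le | exact: star_opG_le
  |exact: le_star_opP | exact: le_star_opF].
Qed.
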